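(* Let $G$ be a locally finite graph (finite or infinite, not necessarily connected) without a connected component isomorphic to $K_2$. Then $D'_{l,s}(G)\leq 3$.
   Context: Graphs are simple and undirected, and may be finite or infinite. A graph is locally finite if every vertex has finite degree. An automorphism $\varphi$ of $G$ is small if there is a vertex $v\in V(G)$ such that $\varphi(v)$ is a neighbour of $v$. Edge colourings are not required to be proper. An edge colouring $c$ of $G$ breaks an automorphism $\varphi$ of $G$ if $\varphi$ does not preserve $c$, i.e. there is an edge $e=xy$ with $c(\varphi(x)\varphi(y))\neq c(xy)$. The small list distinguishing index $D'_{l,s}(G)$ is the least $k$ such that for every assignment $\{L_e\}_{e\in E(G)}$ of lists (sets of colours) of size $k$ to the edges of $G$ there exists an edge colouring $c$ of $G$ with $c(e)\in L_e$ for every $e\in E(G)$ which breaks every small automorphism of $G$. *)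

(* Defs.v *)
From mathcomp Require Import all_boot.
From mathcomp Require Import boolp classical_sets functions cardinality.
From Stdlib Require Import Relation_Operators.
Set Implicit Arguments.
Unset Strict Implicit.
Unset Printing Implicit Defensive.
Local Open Scope classical_set_scope.
Local Open Scope card_scope.

Record graph := Graph {
  vertex :> Type;
  adj : vertex -> vertex -> Prop;
  adj_sym : forall x y, adj x y -> adj y x;
  adj_irrefl : forall x, ~ adj x x }.

Definition neighbourhood (G : graph) (x : G) : set G := [set y | adj x y].

Definition locally_finite (G : graph) : Prop :=
  forall x : G, finite_set (neighbourhood x).

Definition isomorphic (G H : graph) : Prop :=
  exists f : G -> H,
    bijective f /\ forall x y, adj (f x) (f y) <-> adj x y.

Definition induced (G : graph) (A : set G) : graph :=
  @Graph (set_type A) (fun x y => adj (\val x) (\val y))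
    (fun x y => @adj_sym G (\val x) (\val y))
    (fun x => @adj_irrefl G (\val x)).

Definition complete_graph (n : nat) : graph :=
  @Graph 'I_n (fun x y => x <> y)
    (fun x y xy yx => xy (esym yx)) (fun x xx => xx erefl).

Definition connected_component (G : graph) (A : set G) : Prop :=
  exists x : G, A = [set y | clos_refl_trans G (@adj G) x y].

(* Colourings and list assignments are functions on this type of unordered
   pairs, so that they carry no data on non-edges; in particular an edgeless
   graph has a colouring even when there are no colours. *)
Definition edge (G : graph) : Type :=
  {e : set G | exists x y, adj x y /\ e = [set x; y]}.

Definition mk_edge (G : graph) (x y : G) (xy : adj x y) : edge G :=
  exist _ [set x; y] (ex_intro _ x (ex_intro _ y (conj xy erefl))).

Record automorphism (G : graph) := Automorphism {
  aut_fun :> G -> G;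
  aut_bij : bijective aut_fun;
  aut_adj : forall x y, adj (aut_fun x) (aut_fun y) <-> adj x y }.

Definition small (G : graph) (phi : automorphism G) : Prop :=
  exists v : G, adj v (phi v).

Definition breaks (G : graph) (C : Type) (c : edge G -> C)
    (phi : automorphism G) : Prop :=
  exists (x y : G) (xy : adj x y),
    c (mk_edge (proj2 (aut_adj phi x y) xy)) <> c (mk_edge xy).

Definition small_list_distinguishable (G : graph) (k : nat) : Prop :=
  forall (C : Type) (L : edge G -> set C),
    (forall e, L e #= `I_k) ->
    exists c : edge G -> C,
      (forall e, L e (c e)) /\
      (forall phi : automorphism G, small phi -> breaks c phi).

(* The index is a relation rather than a function because a graph may have no
   admissible k at all (K_2 has none). *)
Definition small_list_distinguishing_index (G : graph) (k : nat) : Prop :=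
  small_list_distinguishable G k /\
  forall j : nat, small_list_distinguishable G j -> (k <= j)%N.

(* Main.v *)
(* A small automorphism maps some component to itself, so each component is
   coloured separately.  Such a component has a vertex x of degree at least 2;
   as it is countable, it has a normal spanning tree rooted at x (every edge
   joins a vertex to one of its ancestors).  Colour the edges so that, for
   every child t of a vertex u, the colour of ut occurs only once among the
   edges from u to the subtree of t, and so that one colour occurs only on a
   single tree edge xw.  If a colour-preserving automorphism phi fixes x and v
   is adjacent to phi v, then phi fixes the ancestors of v one after another:
   when it fixes u and everything above u, it preserves the component
   containing v and phi v of what remains, which is the subtree of the next
   ancestor t, and hence fixes t.  So it fixes v, which is absurd.  A
   colour-preserving small automorphism must therefore swap x and w.  A further
   edge xz can be chosen that has two admissible colours, and for at least one
   of them x and w see different numbers of edges of some colour, so that no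
   swap is possible.  Each edge has to avoid at most two colours. *)
Require Import Defs.
From mathcomp Require Import all_boot.
From mathcomp Require Import boolp classical_sets functions cardinality.
From mathcomp Require Import zify.
From Stdlib Require Import Relation_Operators.
Set Implicit Arguments.
Unset Strict Implicit.
Unset Printing Implicit Defensive.
Local Open Scope classical_set_scope.

(** * Walks and components inside a vertex set *)

Definition reach (G : graph) (x : G) : set G :=
  [set y | clos_refl_trans G (@adj G) x y].

Inductive walk (G : graph) (K : set G) : nat -> G -> G -> Prop :=
| walk0 x : K x -> walk K 0 x x
| walkS n x y z : K x -> adj x y -> walk K n y z -> walk K n.+1 x z.

Section Walks.
Variable G : graph.
Implicit Types (x y z r v : G) (K : set G).

Lemma reach_refl x : reach x x.
Proof. exact: rt_refl. Qed.

Lemma reach_trans x y z : reach x y -> reach y z -> reach x z.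
Proof. by move=> xy yz; apply: rt_trans xy yz. Qed.

Lemma adj_reach x y : adj x y -> reach x y.
Proof. by move=> xy; apply: rt_step. Qed.

Lemma reach_sym x y : reach x y -> reach y x.
Proof.
elim=> {x y} [x y xy|x|x y z _ yx _ zy]; first exact/adj_reach/adj_sym.
  exact: reach_refl.
exact: reach_trans zy yx.
Qed.

Lemma reach_adj x y z : reach x y -> adj y z -> reach x z.
Proof. by move=> xy /adj_reach; apply: reach_trans. Qed.

Lemma reach_eq x y : reach x y -> reach x = reach y.
Proof.
move=> xy; apply/seteqP; split=> z; apply: reach_trans => //.
exact: reach_sym.
Qed.

Lemma walk_source K n x y : walk K n x y -> K x.
Proof. by case. Qed.

Lemma walk_target K n x y : walk K n x y -> K y.
Proof. by elim. Qed.

Lemma walk_trans K m n x y z :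
  walk K m x y -> walk K n y z -> walk K (m + n) x z.
Proof.
elim=> [{}x //|{}m {}x x' {}y Kx xx' _ IH] yz.
by rewrite addSn; apply: walkS xx' (IH yz).
Qed.

Lemma walk_sym K n x y : walk K n x y -> walk K n y x.
Proof.
elim=> [{}x Kx|{}n {}x x' {}y Kx xx' x'y IH]; first exact: walk0.
rewrite -addn1; apply: walk_trans IH _.
by apply: walkS (walk_source x'y) (adj_sym xx') (walk0 Kx).
Qed.

Lemma reach_walk x y : reach x y -> exists n, walk (reach x) n x y.
Proof.
move=> xy; have: reach x x by exact: reach_refl.
move: {1 3}x => x0; elim: xy => {x y} [x y xy|x|x y z _ IH1 _ IH2] x0x.
- by exists 1; apply: (walkS x0x xy); apply: walk0; apply: reach_adj xy.
- by exists 0; apply: walk0.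
- have [m w1] := IH1 x0x; have [n w2] := IH2 (walk_target w1).
  by exists (m + n); apply: walk_trans w1 w2.
Qed.

(** Cut the walk after its last visit to [r]. The strict [k < n] is what later makes the distance to
    the target drop. *)
Lemma walk_last_exit K n r z : walk K n r z -> z <> r ->
  exists y k, [/\ adj r y, k < n & walk (K `\ r) k y z].
Proof.
suff H x : walk K n x z -> z <> r -> walk (K `\ r) n x z \/
    exists y k, [/\ adj r y, k < n & walk (K `\ r) k y z].
  by move=> w zr; case: (H _ w zr) => // /walk_source [] _ /(_ erefl).
elim=> {x n z} [x Kx xr|n x y z Kx xy w IH zr]; first by left; apply: walk0.
have [{}w|[y' [k [ry' kn {}w]]]] := IH zr.
  have [xr|xr] := pselect (x = r); last by left; apply: (walkS _ xy w).
  by right; exists y, n; split=> //; rewrite -xr.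
by right; exists y', k; split=> //; apply: ltnW.
Qed.

(** The component of [v] in [K] minus [r], empty if [v] is not in that set. *)
Definition below K r v : set G := [set y | exists k, walk (K `\ r) k v y].

Lemma below_adj K r v y z :
  below K r v y -> adj y z -> K z -> z <> r -> below K r v z.
Proof.
move=> [k w] yz Kz zr; exists (k + 1); apply: (walk_trans w).
by apply: (walkS (walk_target w) yz (walk0 _)).
Qed.

Lemma belowW K r v y : below K r v y -> (K `\ r) y.
Proof. by case=> k /walk_target. Qed.

Lemma walk_below K r v k y z :
  below K r v y -> walk (K `\ r) k y z -> walk (below K r v) k y z.
Proof.
move=> by_ w; elim: w by_ => {k y z} [y _|k y y' z _ yy' w IH] by_.
  exact: walk0.
have [Ky' y'r] := walk_source w.
exact: walkS by_ yy' (IH (below_adj by_ yy' Ky' y'r)).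
Qed.

Lemma below_connected K r v y z : below K r v y -> below K r v z ->
  exists k, walk (below K r v) k y z.
Proof.
move=> by_ [k w]; case: (by_) => k' w'.
by exists (k' + k); apply: walk_below by_ (walk_trans (walk_sym w') w).
Qed.

Lemma below_eq K r v y : below K r v y -> below K r v = below K r y.
Proof.
move=> [k w]; apply/seteqP; split=> z [k' w'].
  by exists (k + k'); apply: walk_trans (walk_sym w) w'.
by exists (k + k'); apply: walk_trans w w'.
Qed.

End Walks.

(** * Construction of a normal spanning tree *)

(* [par v] is meaningful only for [v <> x]; the last clause is normality: of two
   adjacent vertices, the one of smaller height is an ancestor of the other. *)
Definition normal_tree (G : graph) (x : G) (par : G -> G) (h : G -> nat) :=
  [/\ h x = 0,
      forall v, reach x v -> h v = 0 -> v = x,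
      forall v, reach x v -> 0 < h v -> adj (par v) v /\ h (par v) = (h v).-1 &
      forall u v, reach x u -> adj u v -> h u <= h v ->
        iter (h v - h u) par v = u].

Section NormalTree.
Variables (G : graph) (x : G) (e : G -> nat).
Hypothesis e_inj : {in reach x &, injective e}.
(** [target] and [pick] depend only on the piece and the old root, so vertices in the same piece get
    the same next root. *)
Variable target : set G -> G.
Hypothesis targetP :
  forall K y, K y -> K (target K) /\ e (target K) <= e y.
Variable pick : G -> set G -> G.
Hypothesis pickP : forall r K y k, adj r y -> walk K k y (target K) ->
  adj r (pick r K) /\ exists2 k', k' <= k & walk K k' (pick r K) (target K).

(* The decreasing sequence of connected sets containing [v], each with its root:
   remove the root, keep the component of [v], and take as its new root a
   neighbour of the old one which is as close as possible to the vertex of least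
   [e]-value.  Moving towards that vertex ensures that [v] itself becomes a root
   after finitely many stages. *)
Fixpoint stage (v : G) (n : nat) : set G * G :=
  if n is m.+1 then
    let: (K, r) := stage v m in (below K r v, pick r (below K r v))
  else (reach x, x).

Let part v n := (stage v n).1.
Let top v n := (stage v n).2.

Lemma partS v n : part v n.+1 = below (part v n) (top v n) v.
Proof. by rewrite /part /top /=; case: stage. Qed.

Lemma topS v n : top v n.+1 = pick (top v n) (part v n.+1).
Proof. by rewrite /part /top /=; case: stage. Qed.

Lemma part_sub v n : part v n `<=` reach x.
Proof.
elim: n => [|n IH] y //; rewrite partS => /belowW [] /IH //.
Qed.

Lemma partW v m n : m <= n -> part v n `<=` part v m.
Proof.
move=> /subnK <-; elim: (n - m) => [|k IH] y //.
by rewrite addSn partS => /belowW [] /IH.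
Qed.

Lemma pick_below K r v :
  (forall y, K y -> exists k, walk K k r y) -> K v -> v <> r ->
  adj r (pick r (below K r v)) /\ below K r v (pick r (below K r v)).
Proof.
move=> conn Kv vr; have [k w] := conn v Kv.
have [y [k' [ry _ w']]] := walk_last_exit w vr.
have by_ : below K r v y by exists k'; apply: walk_sym.
have [bt _] := targetP by_.
have [k2 w2] := below_connected by_ bt.
by have [rp [k3 _ /walk_source]] := pickP ry w2.
Qed.

(** Once [v] has been a root, all later pieces are empty, hence the restriction to stages up to that
    point. *)
Lemma part_rooted v n : reach x v -> (forall m, m < n -> top v m <> v) ->
  [/\ part v n v, part v n (top v n) &
      forall y, part v n y -> exists k, walk (part v n) k (top v n) y].
Proof.
move=> xv; elim: n => [|n IH] tv.
  by split=> //; [apply: reach_refl|move=> y; apply: reach_walk].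
have [pv pt conn] := IH (fun m mn => tv m (ltnW mn)).
have vt : v <> top v n by move=> vt; apply: (tv n) => //.
have [_ bp] := pick_below conn pv vt.
rewrite topS partS; split=> //; first by exists 0; apply: walk0.
by move=> y; apply: below_connected.
Qed.

Lemma top_adj v n : reach x v -> (forall m, m <= n -> top v m <> v) ->
  adj (top v n) (top v n.+1).
Proof.
move=> xv tv.
have [pv pt conn] := part_rooted xv (fun m mn => tv m (ltnW mn)).
have vt : v <> top v n by move=> vt; apply: (tv n) => //.
by rewrite topS partS; have [] := pick_below conn pv vt.
Qed.

Lemma top_reaches v : reach x v -> exists n, top v n = v.
Proof.
move=> xv; apply: contrapT => no.
have tv n : top v n <> v by move=> h; apply: no; exists n.
have rooted n := part_rooted (n := n) xv (fun m _ => tv m).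
(* [a] bounds how much the [e]-value of the target can still grow, [b] its distance from the current
   root. *)
suff H a b n : e v - e (target (part v n)) <= a ->
    (exists2 k, k <= b & walk (part v n) k (top v n) (target (part v n))) ->
    False.
  have [pv _ conn] := rooted 0; have [bt _] := targetP pv.
  by have [k w] := conn _ bt; apply: (H _ k 0 (leqnn _)); exists k.
(* Lexicographic descent: if the target survives, its distance to the root
   drops; otherwise its [e]-value, which is at most [e v], increases. *)
elim/ltn_ind: a b n => a IHa; elim/ltn_ind => b IHb n ea [k kb w].
have [pv pt conn] := rooted n.
have [pv' pt' conn'] := rooted n.+1.
have [bt bmin] := targetP pv; have [bt' bmin'] := targetP pv'.
have sub := @partW v _ _ (leqnSn n).
have [tin|tout] := pselect (part v n.+1 (target (part v n))).
  have tE : target (part v n.+1) = target (part v n).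
    apply: e_inj; rewrite ?inE; try exact: part_sub bt.
      exact: part_sub bt'.
    by apply/eqP; rewrite eqn_leq (targetP tin).2 (targetP (sub _ bt')).2.
  have tr : target (part v n) <> top v n.
    by move=> tr; move: tin; rewrite partS tr => /belowW [_ /(_ erefl)].
  have [y [k' [ry kk' w']]] := walk_last_exit w tr.
  have w2 : walk (part v n.+1) k' y (target (part v n.+1)).
    rewrite tE partS; apply: (walk_below _ w').
    move: tin; rewrite partS => /below_eq ->.
    by exists k'; apply: walk_sym.
  have [_ [k2 k2k' w3]] := pickP ry w2.
  apply: (IHb k' _ n.+1); [lia| by rewrite tE|exists k2 => //].
  by rewrite topS.
have lt : e (target (part v n)) < e (target (part v n.+1)).
  rewrite ltn_neqAle (targetP (sub _ bt')).2 andbT; apply/eqP => eE.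
  apply: tout; have -> // : target (part v n) = target (part v n.+1).
  apply: e_inj => //; rewrite inE; [exact: part_sub bt|exact: part_sub bt'].
have [k' w'] := conn' _ bt'.
by apply: (IHa (e v - e (target (part v n.+1))) _ k' n.+1) => //;
  [lia|exists k'].
Qed.

Lemma stage_eq v n y : part v n y -> forall m, m <= n -> stage y m = stage v m.
Proof.
elim: n => [|n IH] py m; first by rewrite leqn0 => /eqP ->.
have {}IH := IH (partW (leqnSn n) py).
rewrite leq_eqVlt ltnS => /orP[/eqP ->|/IH //].
move: py; rewrite partS /part /top /= IH //; case: stage => K r /= /below_eq ->.
by [].
Qed.

(** The source of normality: the ends of an edge stay in one component until one of them is
    removed. *)
Lemma stage_adj u v n : reach x u -> adj u v ->
  (forall m, m < n -> top u m <> u /\ top v m <> v) -> stage u n = stage v n.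
Proof.
move=> xu uv; elim: n => [//|n IH] tuv.
have sE := IH (fun m mn => tuv m (ltnW mn)).
have [pu _ _] := part_rooted xu (fun m mn => (tuv m (ltnW mn)).1).
have [pv _ _] := part_rooted (reach_adj xu uv)
                             (fun m mn => (tuv m (ltnW mn)).2).
have [tu tv] := tuv n (leqnn _).
have bv : below (part u n) (top u n) u v.
  have ut : u <> top u n by move=> h; apply: tu.
  apply: (below_adj _ uv); first by exists 0; apply: walk0.
    by rewrite /part sE.
  by rewrite /top sE => h; apply: tv.
move: bv => /= /below_eq; rewrite /part /top sE.
by case: stage => K r /= ->.
Qed.

Lemma top_tree : exists (par : G -> G) (h : G -> nat), normal_tree x par h.
Proof.
(* The height is the first stage at which [v] is the root. *)
have /choice[h hP] : forall v, exists n, reach x v ->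
    top v n = v /\ forall m, m < n -> top v m <> v.
  move=> v; have [xv|] := pselect (reach x v); last by exists 0.
  have ex : exists n, `[< top v n = v >].
    by have [n tn] := top_reaches xv; exists n; apply/asboolP.
  have [n /asboolP tn min] := ex_minnP ex.
  exists n => _; split=> // m mn /asboolP /min; lia.
have hE y n : reach x y -> top y n = y -> (forall m, m < n -> top y m <> y) ->
    h y = n.
  move=> xy tn lt; have [th min] := hP _ xy.
  by have [/lt|/min|] := ltngtP (h y) n.
(* The roots met on the way to [v] share its stages, and earlier roots are no longer in the
   piece. *)
have top_le v n : reach x v -> n <= h v ->
    [/\ reach x (top v n), h (top v n) = n &
        forall m, m <= n -> top (top v n) m = top v m].
  move=> xv nh; have [tv min] := hP _ xv.
  have [pv pt _] := part_rooted xv (fun m mn => min m (leq_trans mn nh)).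
  have xt := part_sub pt.
  have sE m : m <= n -> top (top v n) m = top v m.
    by move=> mn; rewrite /top (stage_eq pt mn).
  split=> //; apply: hE => // [|m mn]; first exact: sE.
  rewrite sE; last exact: ltnW.
  by have := partW mn pt; rewrite partS => /belowW[_ /= tt /esym].
(* The parent is the root one stage earlier; at [x] this gives [x] itself as a default. *)
exists (fun v => top v (h v).-1), h; split.
- by apply: hE => //; apply: reach_refl.
- by move=> v xv h0; have [<- _] := hP _ xv; rewrite h0.
- move=> v xv h0; have [tv min] := hP _ xv.
  have [_ hE' _] := top_le v (h v).-1 xv (leq_pred _).
  split=> //; have := @top_adj v (h v).-1 xv; rewrite (prednK h0) tv; apply.
  by move=> m mh; apply: min; lia.
- move=> u v xu uv huv; have xv := reach_adj xu uv.
  have [tv minv] := hP _ xv; have [tu minu] := hP _ xu.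
  have iterE k : k <= h v ->
      iter k (fun v => top v (h v).-1) v = top v (h v - k).
    elim: k => [_|k IH kh] /=; first by rewrite subn0.
    rewrite IH; last exact: ltnW.
    have [_ -> tE] := top_le v (h v - k) xv (leq_subr _ _).
    by rewrite tE ?leq_pred // subnS.
  rewrite iterE ?leq_subr // subKn // -[RHS]tu /top; congr (_.2); apply/esym.
  apply: stage_adj => // m mh; split; first exact: minu.
  by apply: minv; apply: leq_trans huv.
Qed.

End NormalTree.

Lemma reach_countable (G : graph) (x : G) :
  locally_finite G -> countable (reach x).
Proof.
move=> lf.
(* The ends of walks of length exactly [n] from [x]. *)
pose fix ball n : set G :=
  if n is m.+1 then \bigcup_(y in ball m) neighbourhood y else [set x].
have fin n : finite_set (ball n).
  by elim: n => [|n IH] /=; [apply: finite_set1|apply: bigcup_finite].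
have -> : reach x = \bigcup_(n in [set: nat]) ball n.
  apply/seteqP; split=> [y /reach_walk [n w]|y [n _]].
    exists n => //; elim: n y w => [|n IH] y w; first by inversion w.
    move: w => /walk_sym w; inversion w as [|? ? z ? xz yz zy]; subst.
    by exists z; [apply: IH; apply: walk_sym|apply: adj_sym].
  elim: n y => [y ->|n IH y /= [z /IH xz]]; first exact: reach_refl.
  exact: reach_adj.
apply: bigcup_countable => // n _; exact: finite_set_countable.
Qed.

(** Countability numbers the component; minima of sets of naturals give [target] and [pick], with
    [x] as a default where there is no candidate. *)
Lemma normal_tree_exists (G : graph) (x : G) : locally_finite G ->
  exists (par : G -> G) (h : G -> nat), normal_tree x par h.
Proof.
move=> /(reach_countable x) /countable_injP[e e_inj].
have /choice[target targetP] : forall K : set G, exists t,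
    forall y, K y -> K t /\ e t <= e y.
  move=> K; have [[y Ky]|K0] := pselect (exists y, K y); last first.
    by exists x => y Ky; case: K0; exists y.
  have ex : exists n, `[< exists2 y, K y & e y = n >].
    by exists (e y); apply/asboolP; exists y.
  have [n /asboolP[t Kt <-] min] := ex_minnP ex.
  by exists t => z Kz; split=> //; apply: min; apply/asboolP; exists z.
have /choice[pick pickP] : forall s : G * set G, exists p, forall y k,
    adj s.1 y -> walk s.2 k y (target s.2) ->
    adj s.1 p /\ exists2 k', k' <= k & walk s.2 k' p (target s.2).
  move=> [r K] /=; pose P k := exists2 y, adj r y & walk K k y (target K).
  have [[k Pk]|P0] := pselect (exists k, P k); last first.
    by exists x => y k ry w; case: P0; exists k, y.
  have ex : exists k, `[< P k >] by exists k; apply/asboolP.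
  have [n /asboolP[p rp w] min] := ex_minnP ex.
  exists p => y k' ry w'; split=> //; exists n => //.
  by apply: min; apply/asboolP; exists y.
apply: (@top_tree G x e e_inj target targetP (fun r K => pick (r, K))).
by move=> r K y k; apply: (pickP (r, K)).
Qed.

(** * Automorphisms acting on one component *)

Definition preserves (G : graph) (C : Type) (x : G) (f : G -> G -> C)
    (phi : automorphism G) :=
  forall u v, reach x u -> adj u v -> f (phi u) (phi v) = f u v.

Section Automorphisms.
Variables (G : graph) (phi : automorphism G).

Lemma aut_inj : injective phi.
Proof. exact: bij_inj (aut_bij phi). Qed.

Lemma aut_adj_imp u v : adj u v -> adj (phi u) (phi v).
Proof. by move=> uv; apply/aut_adj. Qed.

Lemma aut_reach u v : reach u v -> reach (phi u) (phi v).
Proof.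
elim=> {u v} [u v uv|u|u v y _ uv _ vy].
- exact/adj_reach/aut_adj_imp.
- exact: reach_refl.
- exact: reach_trans uv vy.
Qed.

End Automorphisms.

(** * Colourings adapted to a normal tree *)

Section TreeColouring.
Variables (G : graph) (x : G) (par : G -> G) (h : G -> nat).
Hypothesis tree : normal_tree x par h.

(* The ancestor of [v] at height [n], provided that [n <= h v]. *)
Definition anc v n := iter (h v - n) par v.

Lemma anc_id v : anc v (h v) = v.
Proof. by rewrite /anc subnn. Qed.

Lemma anc_height v n : reach x v -> n <= h v ->
  reach x (anc v n) /\ h (anc v n) = n.
Proof.
have [_ _ parP _] := tree => xv nv; rewrite /anc.
have : h v - n <= h v by exact: leq_subr.
rewrite -{4}(subKn nv); elim: (h v - n) => [|k IH] kv /=.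
  by rewrite subn0.
have [xk hk] := IH (ltnW kv).
have [|pk ->] := parP _ xk; first by rewrite hk subn_gt0.
by split; [apply: reach_adj xk (adj_sym pk)|rewrite hk subnS].
Qed.

Lemma anc_anc v n m : reach x v -> m <= n -> n <= h v ->
  anc (anc v n) m = anc v m.
Proof.
move=> xv mn nv; rewrite {1}/anc (anc_height xv nv).2 /anc -iterD.
by congr (iter _ _ _); lia.
Qed.

Lemma anc_root v : reach x v -> anc v 0 = x.
Proof.
have [_ rootP _ _] := tree => xv.
by have [xa ha] := anc_height xv (leq0n _); apply: rootP.
Qed.

Lemma anc_adj v n : reach x v -> n < h v -> adj (anc v n) (anc v n.+1).
Proof.
have [_ _ parP _] := tree => xv nv.
have [xa ha] := anc_height xv nv.
have [|] := parP _ xa; first by rewrite ha.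
by rewrite {1}/anc -iterS -subSn.
Qed.

Lemma anc_of_adj u v : reach x u -> adj u v -> h u <= h v -> anc v (h u) = u.
Proof. by have [_ _ _ normP] := tree => xu uv /normP; apply. Qed.

Lemma height_adj u v : reach x u -> adj u v -> h u <> h v.
Proof.
move=> xu uv huv; have := anc_of_adj xu uv; rewrite huv leqnn anc_id.
by move=> /(_ isT) vu; apply: (@adj_irrefl _ u); rewrite -{2}vu.
Qed.

Lemma height_root : h x = 0.
Proof. by have [] := tree. Qed.

Lemma adj_root_height v : adj x v -> 0 < h v.
Proof.
have [_ rootP _ _] := tree => xv; rewrite lt0n; apply/eqP => /rootP.
move=> /(_ (adj_reach xv)) vx; apply: (@adj_irrefl _ x).
by rewrite -{2}vx.
Qed.

Variable C : Type.
Implicit Types f : G -> G -> C.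

(* [anc v (h u).+1] is the child [t] of [u] below which [v] lies; the last
   clause makes the colour of the edge [u t] unique among the edges from [u] to
   the subtree of [t]. *)
Definition rigid f (w : G) (a : C) :=
  [/\ forall u v, reach x u -> adj u v -> f u v = f v u,
      f x w = a,
      forall u v, reach x u -> adj u v -> f u v = a ->
        u = x /\ v = w \/ u = w /\ v = x &
      forall u v, reach x u -> adj u v -> h u < h v -> anc v (h u).+1 <> v ->
        f u v <> f u (anc v (h u).+1)].

Lemma rigid_root_moved f w a (phi : automorphism G) v :
  rigid f w a -> preserves x f phi -> reach x v -> adj v (phi v) ->
  phi x <> x.
Proof.
move=> [_ _ _ fchild] pf xv vphi phix.
suff fixed n : n <= h v -> phi (anc v n) = anc v n.
  have := fixed (h v) (leqnn _); rewrite anc_id => phiv.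
  by apply: (@adj_irrefl _ v); rewrite -{2}phiv.
elim/ltn_ind: n; case=> [_ _|n IH nv]; first by rewrite anc_root.
(* the subtree of the next ancestor of [v] *)
pose S y := [/\ reach x y, n < h y & anc y n.+1 = anc v n.+1].
(* By normality, an edge can leave the subtree only towards an ancestor of [v] of height at most
   [n]. *)
have S_adj y y' : S y -> adj y y' -> (forall m, m <= n -> y' <> anc v m) ->
    S y'.
  move=> [xy ny ay] yy' no; have xy' := reach_adj xy yy'.
  have [hyy|hyy] := leqP (h y) (h y').
    split=> //; first exact: leq_trans hyy.
    by rewrite -(anc_anc xy' ny hyy) anc_of_adj.
  have ay' := anc_of_adj xy' (adj_sym yy') (ltnW hyy).
  have [ny'|ny'] := ltnP n (h y').
    by split=> //; rewrite -{1}ay' anc_anc // ltnW.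
  case: (no (h y') ny'); rewrite -{1}ay' -(anc_anc xy (leqW ny') ny) ay.
  by rewrite anc_anc // leqW.
(* Follow the image of the tree path from [v] up to the next ancestor: it starts next to [v] and, by
   injectivity, avoids the fixed ancestors. *)
have Sphi k : k <= h v - n.+1 -> S (phi (anc v (h v - k))).
  elim: k => [_|k IHk kv].
    rewrite subn0 anc_id; apply: (S_adj v) => // m mn.
    have mv : m < h v by exact: leq_ltn_trans nv.
    rewrite -(IH m) ?ltnS // 1?ltnW // => /aut_inj vE.
    by have := (anc_height xv (ltnW mv)).2; rewrite -vE; lia.
  apply: S_adj (IHk (ltnW kv)) _ _.
    apply/aut_adj_imp/adj_sym.
    have -> : h v - k = (h v - k.+1).+1 by lia.
    by apply: anc_adj => //; lia.
  move=> m mn; have mv : m < h v by exact: leq_ltn_trans nv.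
  rewrite -(IH m) ?ltnS // 1?ltnW // => /aut_inj aE.
  have := (anc_height xv (ltnW mv)).2.
  rewrite -aE (anc_height xv (leq_subr _ _)).2; lia.
have [xt nt at_] : S (phi (anc v n.+1)).
  by have := Sphi _ (leqnn _); rewrite subKn.
have [xa ha] := anc_height xv (ltnW nv).
have aphi := aut_adj_imp phi (anc_adj xv nv).
have phia := IH _ (leqnn _) (ltnW nv).
(* The tree edge and its image leave the same fixed vertex with the same colour and end in the same
   subtree, so uniqueness of that colour forces equal ends. *)
apply: contrapT => tE.
have := fchild (anc v n) (phi (anc v n.+1)) xa.
rewrite -{1}phia ha at_ => /(_ aphi nt) [|]; first by move=> /esym.
by rewrite -{1}phia; apply: pf => //; apply: anc_adj.
Qed.

(** As [x w] is the only edge of colour [a] in the component, its ends are fixed or swapped, and [x]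
    is not fixed. *)
Lemma rigid_swap f w a (phi : automorphism G) v :
  adj x w -> rigid f w a -> preserves x f phi -> reach x v -> adj v (phi v) ->
  phi x = w /\ phi w = x.
Proof.
move=> xw rf pf xv vphi; have [_ fw fa _] := rf.
have xphi : reach x (phi x).
  apply: reach_trans (reach_adj xv vphi) _.
  exact/aut_reach/reach_sym.
have [|[phix _]|//] := fa _ _ xphi (aut_adj_imp phi xw).
  by rewrite pf //; apply: reach_refl.
by case: (rigid_root_moved rf pf xv vphi).
Qed.

Definition recolour f (z : G) (b : C) (u v : G) :=
  if `[< u = x /\ v = z \/ u = z /\ v = x >] then b else f u v.

Lemma recolour_root f z b : recolour f z b x z = b.
Proof. by rewrite /recolour; case: asboolP => // -[]; left. Qed.

Lemma recolour_other f z b u v : ~ (u = x /\ v = z) -> ~ (u = z /\ v = x) ->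
  recolour f z b u v = f u v.
Proof. by rewrite /recolour; case: asboolP => // -[]. Qed.

(** If [z] lies below [w], the edge [x z] is compared only with [x w], whose colour [a] differs from
    [b]; otherwise every neighbour of [x] is a child and nothing is compared at [x]. *)
Lemma rigid_recolour f w a z b :
  rigid f w a -> adj x w -> adj x z -> z <> w -> b <> a ->
  anc z 1 = w \/ (forall v, adj x v -> anc v 1 = v) ->
  rigid (recolour f z b) w a.
Proof.
move=> [fsym fw fa fchild] xw xz zw ba zP.
have xx : reach x x by exact: reach_refl.
have irr v : adj x v -> v <> x by move=> + vx; rewrite vx; apply: adj_irrefl.
split=> [u v xu uv||u v xu uv|u v xu uv huv tv].
- rewrite /recolour fsym //; congr (if _ then _ else _).
  by apply: asbool_equiv_eq; tauto.
- by rewrite recolour_other // => -[] // _ wz; [apply: zw|apply: (irr w)].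
- by rewrite /recolour; case: asboolP => [_ /ba|_ /fa]; last apply.
- rewrite {1}/recolour; case: asboolP => [[[ux vz]|[uz vx]]|uvP].
  + subst u v; rewrite height_root in tv *.
    case: zP => [zE|/(_ _ xz) //]; rewrite zE recolour_other ?fw //.
      by move=> [_ /esym].
    by move=> [/esym/irr].
  + by move: huv; rewrite vx height_root.
  + rewrite recolour_other; first exact: fchild.
      move=> [ux]; rewrite ux height_root => tz; subst u.
      case: zP => [|/(_ _ uv)]; last by rewrite height_root in tv.
      by have := zw; rewrite -tz anc_anc ?adj_root_height //; apply: adj_reach.
    move=> [_ tx]; have := (anc_height (reach_adj xu uv) huv).2.
    by rewrite tx height_root.
Qed.

Lemma rigid_exists (L : G -> G -> set C) w a :
  (forall u v, L u v = L v u) ->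
  (forall u v b c, adj u v -> exists d, [/\ L u v d, d <> b & d <> c]) ->
  adj x w -> h w = 1 -> L x w a ->
  exists f, rigid f w a /\
    forall u v, reach x u -> adj u v -> L u v (f u v).
Proof.
move=> Lsym Lbig xw hw Lxw.
have /choice[pk pkP] : forall s : G * G * C, exists d, adj s.1.1 s.1.2 ->
    [/\ L s.1.1 s.1.2 d, d <> a & d <> s.2].
  move=> [[u v] b] /=; have [uv|] := pselect (adj u v); last by exists a.
  by have [d] := Lbig u v a b uv; exists d.
(* [B] colours tree edges and need only avoid [a], hence the repeated [a]. [D] makes every other
   edge also avoid the colour of the tree edge towards its lower end, and [f] orients edges by
   height. *)
pose B u t := if `[< u = x /\ t = w >] then a else pk (u, t, a).
pose D u v := let t := anc v (h u).+1 in
  if `[< t = v >] then B u v else pk (u, v, B u t).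
pose f u v := if h u < h v then D u v else D v u.
have BP u t : adj u t -> L u t (B u t) /\
    (B u t = a -> u = x /\ t = w).
  move=> ut; rewrite /B; case: asboolP => [[-> ->] //|_].
  by have [] := pkP (u, t, a) ut.
have DP u v : adj u v -> L u v (D u v) /\
    (D u v = a -> u = x /\ v = w).
  move=> uv; rewrite /D; case: asboolP => [_|_]; first exact: BP.
  by have [] := pkP (u, v, B u (anc v (h u).+1)) uv.
exists f; split; last first.
  by move=> u v xu uv; rewrite /f; case: ifP => _; [|rewrite Lsym];
    apply: (DP _ _ _).1 => //; apply: adj_sym.
split=> [u v xu uv||u v xu uv|u v xu uv huv tv].
- by rewrite /f; case: ltngtP => // /(height_adj xu uv).
- by rewrite /f height_root hw /D /B; case: asboolP => [_|[]];
    [case: asboolP => // -[]|rewrite height_root -hw anc_id].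
- rewrite /f; case: ifP => _ fa; first by left; apply: (DP _ _ uv).2.
  by right; case: ((DP _ _ (adj_sym uv)).2 fa).
- have xv := reach_adj xu uv; have [xt ht] := anc_height xv huv.
  rewrite /f huv ht ltnSn /D anc_anc //.
  rewrite (asboolF tv) asboolT //.
  have [] := pkP (u, v, B u (anc v (h u).+1)) uv => _ _ //.
Qed.

End TreeColouring.

(** * Excluding a swap of [x] and [w] *)

Lemma finite_inj_onto (T : Type) (A : set T) (s : T -> T) (z : T) :
  finite_set A -> A z -> (forall y, A y -> A (s y)) ->
  {in A &, injective s} -> exists2 y, A y & s y = z.
Proof.
move=> finA Az As s_inj; apply: contrapT => no.
(* If [z] were missed, its iterates would be pairwise distinct. *)
pose orb n := iter n s z.
have Aorb n : A (orb n) by elim: n => //= n; apply: As.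
have orb_inj : injective orb.
  have orb0 n : orb n.+1 <> z by move=> h; apply: no; exists (orb n).
  elim=> [|m IH] [|n] //; [by move/esym/orb0|by move/orb0|].
  by move/s_inj; rewrite !inE => /(_ (Aorb _) (Aorb _))/IH ->.
apply: infinite_nat.
have /eq_finite_set <- : (orb @` setT #= [set: nat])%card.
  by apply: inj_card_eq => ? ? _ _ /orb_inj.
by apply: sub_finite_set finA => _ [n _ <-].
Qed.

(* [psi^-1 \o phi] maps the neighbours of [x] other than [w] with [f1]-colour
   [f1 x z] injectively to themselves, but misses [z]. *)
Lemma no_two_swaps (G : graph) (C : Type) (f1 f2 : G -> G -> C) (x w z : G)
    (phi psi : automorphism G) :
  locally_finite G -> adj x w -> adj x z -> z <> w ->
  (forall u v, ~ (u = x /\ v = z) -> ~ (u = z /\ v = x) -> f1 u v = f2 u v) ->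
  f1 x z <> f2 x z ->
  preserves x f1 phi -> preserves x f2 psi ->
  phi x = w -> phi w = x -> psi x = w -> psi w = x -> False.
Proof.
move=> lf xw xz zw f12 fxz pphi ppsi phix phiw psix psiw.
have irr (v : G) : adj x v -> v <> x.
  by move=> + vx; rewrite vx; apply: adj_irrefl.
have [g gK Kg] := aut_bij psi.
pose A := [set v | [/\ adj x v, v <> w & f1 x v = f1 x z]].
have finA : finite_set A by apply: sub_finite_set (lf x) => v [].
have gphi v : A v -> [/\ adj x (g (phi v)), g (phi v) <> w &
    f2 x (g (phi v)) = f1 x z].
  move=> [xv vw fv].
  have xg : adj x (g (phi v)).
    by apply/(aut_adj psi); rewrite Kg psix -phix; apply: aut_adj_imp.
  split=> //.
    by move=> /(congr1 psi); rewrite Kg psiw -phiw => /aut_inj.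
  rewrite -(ppsi _ _ (reach_refl x) xg) psix Kg -f12.
  - by rewrite -phix pphi //; apply: reach_refl.
  - by move=> [/(irr w)].
  - by move=> [/esym].
(* The [f2]-colour just found is not that of [x z]; away from [z] it is also the [f1]-colour, so the
   map stays in [A]. *)
have gz v : A v -> g (phi v) <> z.
  by move=> /gphi[_ _ fg] gz; apply: fxz; rewrite -fg gz.
have [||||y Ay] := @finite_inj_onto _ A (g \o phi) z => //.
- move=> v Av; have [xg gw fg] := gphi v Av; split=> //=; rewrite -fg f12 //.
    by move=> [_ /(gz v Av)].
  by move=> [/esym/(irr z)].
- by move=> u v _ _ /= /(can_inj Kg)/aut_inj.
- exact: gz.
Qed.

Lemma component_colouring (G : graph) (C : Type) (L : G -> G -> set C)
    (x y1 y2 : G) :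
  locally_finite G -> (forall u v, L u v = L v u) ->
  (forall u v b c, adj u v -> exists d, [/\ L u v d, d <> b & d <> c]) ->
  C -> adj x y1 -> adj x y2 -> y1 <> y2 ->
  exists f : G -> G -> C,
    (forall u v, reach x u -> adj u v -> f u v = f v u /\ L u v (f u v)) /\
    forall phi : automorphism G, preserves x f phi ->
      forall v, reach x v -> ~ adj v (phi v).
Proof.
move=> lf Lsym Lbig c0 xy1 xy2 y12.
have [par [h tree]] := normal_tree_exists x lf.
have h0 := adj_root_height tree.
have child v : adj x v ->
    let w := anc par h v 1 in [/\ adj x w, h w = 1 & reach x w].
  move=> xv /=; have rv := adj_reach xv; have hv := h0 v xv.
  have [xa ha] := anc_height tree rv hv; split=> //.
  by rewrite -{1}(anc_root tree rv); apply: (anc_adj tree).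
(* [zP] leaves the colour of [x z] free: either [z] lies below [w], whose edge to
   [x] has a colour of its own, or [x z] is the only edge from [x] to the branch
   of [z]. *)
have [w [z [xw hw xz zw zP]]] : exists w z, [/\ adj x w, h w = 1, adj x z,
    z <> w & anc par h z 1 = w \/ forall v, adj x v -> anc par h v 1 = v].
  have [[v xv av]|no] := pselect (exists2 v, adj x v & anc par h v 1 <> v).
    have [xa ha _] := child v xv.
    by exists (anc par h v 1), v; split=> //; [move/esym|left].
  have ancE v : adj x v -> anc par h v 1 = v.
    by move=> xv; apply: contrapT => av; apply: no; exists v.
  have [_ h1 _] := child _ xy1; rewrite ancE // in h1.
  by exists y1, y2; split=> //; [move/esym|right].
have [a [La _ _]] := Lbig x w c0 c0 xw.
have [f [rf Lf]] := rigid_exists tree Lsym Lbig xw hw La.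
(* Two distinct candidates for [x z], both different from [a]; if each failed, each would be
   preserved by a swap. *)
have [b1 [Lb1 b1a _]] := Lbig x z a a xz.
have [b2 [Lb2 b2a b12]] := Lbig x z a b1 xz.
have r1 := rigid_recolour tree rf xw xz zw b1a zP.
have r2 := rigid_recolour tree rf xw xz zw b2a zP.
have Lr b u v : L x z b -> reach x u -> adj u v ->
    L u v (recolour x f z b u v).
  move=> Lb xu uv; rewrite /recolour; case: asboolP => [|_]; last exact: Lf.
  by move=> [[-> ->]|[-> ->]] //; rewrite Lsym.
apply: contrapT => none.
have swap b : L x z b -> rigid x par h (recolour x f z b) w a ->
    exists phi : automorphism G,
      [/\ preserves x (recolour x f z b) phi, phi x = w & phi w = x].
  move=> Lb rb; apply: contrapT => no; apply: none; exists (recolour x f z b).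
  split=> [u v xu uv|phi pf v xv vphi].
    by split; [case: rb => rsym _ _ _; apply: rsym|apply: Lr].
  apply: no; exists phi.
  by have [? ?] := rigid_swap tree xw rb pf xv vphi.
have [phi [pphi phix phiw]] := swap _ Lb1 r1.
have [psi [ppsi psix psiw]] := swap _ Lb2 r2.
apply: (no_two_swaps lf xw xz zw _ _ pphi ppsi phix phiw psix psiw).
  by move=> u v uxz uzx; rewrite !recolour_other.
by rewrite !recolour_root => /esym.
Qed.

(** * From components to the whole graph *)

Lemma not_K2_branching (G : graph) (v u : G) :
  (forall A : set G, connected_component A ->
     ~ isomorphic (induced A) (complete_graph 2)) ->
  adj v u ->
  exists x y1 y2, [/\ reach v x, adj x y1, adj x y2 & y1 <> y2].
Proof.
move=> noK2 vu; apply: contrapT => no.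
have uniq x y1 y2 : reach v x -> adj x y1 -> adj x y2 -> y1 = y2.
  by move=> vx xy1 xy2; apply: contrapT => y12; apply: no; exists x, y1, y2.
have uv := adj_sym vu; have ru := adj_reach vu.
have irr : u <> v by move=> uv'; apply: (@adj_irrefl _ v); rewrite -{2}uv'.
(* With unique neighbours, a walk from [v] can only alternate between [v] and [u]. *)
have reachE y : reach v y -> y = v \/ y = u.
  move=> /reach_walk[n /walk_sym w]; elim: n y w => [|n IH] y w.
    by inversion w; left.
  inversion w as [|? ? z ? _ yz zv]; subst.
  have rz := walk_source zv; case: (IH z zv) => zE; subst z.
    by right; apply: (uniq _ _ _ rz (adj_sym yz) vu).
  by left; apply: (uniq _ _ _ rz (adj_sym yz) uv).
have vv : v \in reach v by rewrite inE; apply: reach_refl.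
have uin : u \in reach v by rewrite inE.
apply: (noK2 (reach v)); first by exists v.
pose f (y : induced (reach v)) : complete_graph 2 :=
  if `[< \val y = v >] then ord0 else ord_max.
pose g (i : complete_graph 2) : induced (reach v) :=
  if i == ord0 :> 'I_2 then exist _ v vv else exist _ u uin.
have fg : cancel f g.
  move=> y; apply: val_inj; rewrite /f /g.
  case: asboolP => [->|yv] //=.
  by have [|->] := reachE _ (set_valP y).
have gf : cancel g f.
  move=> i; rewrite /f /g; case: eqVneq => [->|i0] /=; first by rewrite asboolT.
  rewrite asboolF //; apply: val_inj => /=; case: i i0 => -[|[|m]] //.
exists f; split; first by exists g.
move=> y z; split=> /=.
  move=> fyz; have [vy|vy] := reachE _ (set_valP y);
    have [vz|vz] := reachE _ (set_valP z); rewrite ?vy ?vz //.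
    by case: fyz; rewrite /f vy vz.
  by case: fyz; rewrite /f vy vz.
move=> yz /(can_inj fg) E; apply: (@adj_irrefl _ (\val z)).
by rewrite -{1}E.
Qed.

Lemma card3_avoid (C : Type) (L : set C) (b c : C) :
  (L #= `I_3)%card -> exists d, [/\ L d, d <> b & d <> c].
Proof.
rewrite card_eq_sym card_eq_le => /andP[/card_leP[F] _].
pose f i (i3 : `I_3 i) : C := \val (F (exist _ i (mem_set i3))).
have fL i i3 : L (@f i i3) by apply: set_valP.
have f_inj i j i3 j3 : @f i i3 = @f j j3 -> i = j.
  by move=> /val_inj /(@inj _ _ _ F); rewrite !inE => /(_ I I) [].
apply: contrapT => no.
have fbc i i3 : @f i i3 = b \/ @f i i3 = c.
  apply: contrapT => bc; apply: no; exists (f i i3).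
  by split; [apply: fL|move=> h; apply: bc; left|move=> h; apply: bc; right].
have [E0|E0] := fbc 0 isT; have [E1|E1] := fbc 1 isT;
  have [E2|E2] := fbc 2 isT; have := f_inj 0 1 isT isT;
  have := f_inj 0 2 isT isT; have := f_inj 1 2 isT isT;
  rewrite E0 E1 E2 => h12 h02 h01;
  by [move: (h12 erefl)|move: (h02 erefl)|move: (h01 erefl)].
Qed.

Lemma mk_edge_eq (G : graph) (e : edge G) (x y : G) (xy : adj x y) :
  sval e = [set x; y] -> e = mk_edge xy.
Proof. by case: e => e eP /= E; apply: eq_exist. Qed.

Lemma set2_eq (T : Type) (x y u v : T) :
  [set x; y] = [set u; v] -> x <> y -> x = u /\ y = v \/ x = v /\ y = u.
Proof.
move=> E xy.
have [xu|xv] : [set u; v] x by rewrite -E; left.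
  have [yu|yv] : [set u; v] y by rewrite -E; right.
    by case: xy; rewrite xu yu.
  by left.
have [yu|yv] : [set u; v] y by rewrite -E; right.
  by right.
by case: xy; rewrite xv yv.
Qed.

Lemma small_list_distinguishable3 (G : graph) :
  locally_finite G ->
  (forall A : set G, connected_component A ->
     ~ isomorphic (induced A) (complete_graph 2)) ->
  small_list_distinguishable G 3.
Proof.
move=> lf noK2 C L L3.
have [[v0 [u0 vu0]]|no] := pselect (exists u v : G, adj u v); last first.
  (* Without edges [C] may be empty, so no default colour is available. *)
  have noe : edge G -> False.
    by move=> [e [x [y [xy _]]]]; apply: no; exists x, y.
  exists (fun e => False_rect C (noe e)); split=> [e|phi [v vphi]].
    by case: (noe e).
  by case: no; exists v, (phi v).
have [c0] : inhabited C.
  have /eqP/set0P[d _] : L (mk_edge vu0) <> set0.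
    move=> E; have := L3 (mk_edge vu0); rewrite E card_eq_sym card_eq0 => /eqP.
    by rewrite -subset0 => /(_ 0 isT).
  by constructor.
(* Lists on ordered pairs; a non-edge receives every colour. *)
pose M (u v : G) : set C := [set d | forall uv : adj u v, L (mk_edge uv) d].
have MsubS u v : M u v `<=` M v u.
  move=> d Md vu; have <- : mk_edge (adj_sym vu) = mk_edge vu.
    by apply: mk_edge_eq; rewrite /= setUC.
  exact: Md.
have Msym u v : M u v = M v u by apply/seteqP; split; apply: MsubS.
have Mbig u v b c : adj u v -> exists d, [/\ M u v d, d <> b & d <> c].
  move=> uv; have [d [Ld db dc]] := card3_avoid b c (L3 (mk_edge uv)).
  exists d; split=> // uv'.
  by rewrite (_ : uv' = uv) //; apply: Prop_irrelevance.
(* Indexing the choice by the component as a set gives all its vertices the same colouring. *)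
have /choice[F FP] : forall A : set G, exists f : G -> G -> C,
    forall v u, adj v u -> A = reach v ->
    (forall u w, A u -> adj u w -> f u w = f w u /\ M u w (f u w)) /\
    forall phi : automorphism G,
      (forall u w, A u -> adj u w -> f (phi u) (phi w) = f u w) ->
      forall y, A y -> ~ adj y (phi y).
  move=> A; have [[v [u [vu AE]]]|no] :=
    pselect (exists v u, adj v u /\ A = reach v); last first.
    by exists (fun _ _ => c0) => v u vu AE; case: no; exists v, u.
  have [x [y1 [y2 [vx xy1 xy2 y12]]]] := not_K2_branching noK2 vu.
  have [f fP] := component_colouring lf Msym Mbig c0 xy1 xy2 y12.
  by exists f => _ _ _ _; rewrite AE (reach_eq vx).
have /choice[ends endsP] : forall e : edge G, exists p : G * G,
    adj p.1 p.2 /\ sval e = [set p.1; p.2].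
  by move=> [e [x [y [xy eE]]]]; exists (x, y).
pose c e := F (reach (ends e).1) (ends e).1 (ends e).2.
have cE u v (uv : adj u v) : c (mk_edge uv) = F (reach u) u v.
  have u_neq_v : u <> v by move=> E; apply: (@adj_irrefl _ u); rewrite {2}E.
  have [_ /= E] := endsP (mk_edge uv); rewrite /c.
  have [[<- <-] //|[<- <-]] := set2_eq E u_neq_v.
  rewrite -(reach_eq (adj_reach uv)).
  have [FM _] := FP (reach u) u v uv erefl.
  by have [-> _] := FM u v (reach_refl u) uv.
exists c; split=> [e|phi [v vphi]].
  have [pq eE] := endsP e; rewrite {1}(mk_edge_eq pq eE) /c.
  have [FM _] := FP (reach (ends e).1) _ _ pq erefl.
  by have [_] := FM _ _ (reach_refl _) pq; apply.
apply: contrapT => nb.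
have [_ Fphi] := FP (reach v) _ _ vphi erefl.
case: (Fphi phi _ v (reach_refl v) vphi).
move=> u w vu uw.
have cphi : c (mk_edge (proj2 (aut_adj phi u w) uw)) = c (mk_edge uw).
  by apply: contrapT => h; apply: nb; exists u, w, uw.
(* As [v] and [phi v] are adjacent, [phi] preserves the component, so both sides use the same
   colouring. *)
move: cphi; rewrite !cE -(reach_eq vu) => <-; congr (F _ _ _).
by apply: reach_eq; apply: reach_trans (adj_reach vphi) (aut_reach phi vu).
Qed.

Theorem theorem2 (G : graph)
  (G_locally_finite : locally_finite G)
  (G_no_K2 : forall A : set G, connected_component A ->
     ~ isomorphic (induced A) (complete_graph 2)) :
  exists k : nat, small_list_distinguishing_index G k /\ (k <= 3)%N.
Proof.
have sld3 := small_list_distinguishable3 G_locally_finite G_no_K2.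
have ex : exists k, `[< small_list_distinguishable G k >].
  by exists 3; apply/asboolP.
have [k /asboolP kP min] := ex_minnP ex.
exists k; split; last by apply: min; apply/asboolP.
by split=> // j jP; apply: min; apply/asboolP.
Qed.
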